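(* Let $f$ be a Lorentzian polynomial of degree $r$ in $n$ variables with $\mathrm{supp}(f)=J$, let $\kappa\in\mathbb{Z}_{\ge0}^n$, and let $\tau$ define a section of $\mathrm{proj}_\kappa\colon J^{\max_\kappa}\to\mathrm{Ret}_\kappa(J)$. Then $\mathrm{Ret}_\kappa^\tau(f)$ is Lorentzian.
   Context: Let $[n]=\{1,\dots,n\}$, $\Delta_n^r=\{\alpha\in\mathbb{Z}_{\ge0}^n:\alpha_1+\cdots+\alpha_n=r\}$, $\alpha!=\prod_i\alpha_i!$, $w^\alpha=\prod_iw_i^{\alpha_i}$, and order $\mathbb{Z}^n$ coordinatewise. A nonempty $J\subseteq\Delta_n^r$ is M-convex if for all $\alpha,\beta\in J$ and $i$ with $\alpha_i<\beta_i$ there is $j$ with $\alpha_j>\beta_j$ and $\alpha+e_i-e_j,\ \beta-e_i+e_j\in J$. Lorentzian polynomials: for $r=0,1$, every nonzero homogeneous polynomial of degree $r$ in $n$ variables with nonnegative real coefficients is Lorentzian. For $r\ge2$, a homogeneous $f\in\mathbb{R}_{\ge0}[w_1,\dots,w_n]$ of degree $r$ is Lorentzian if $\mathrm{supp}(f)$ is M-convex and, for every $\beta\in\Delta_n^{r-2}$, the Hessian matrix of $\partial^\beta f$ has at most one positive eigenvalue. Here $\mathrm{supp}(f)$ is the set of exponents with nonzero coefficient. $\mathrm{proj}_\kappa(v)_i=\min(v_i,\kappa_i)$. $J^{\max_\kappa}$ is the set of $\alpha\in J$ such that $\mathrm{proj}_\kappa(\alpha)$ is coordinatewise maximal in $\mathrm{proj}_\kappa(J)$,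 and $\mathrm{Ret}_\kappa(J)=\mathrm{proj}_\kappa(J^{\max_\kappa})$. A vector $\tau$ defines a section (is section-defining) if $\tau=\alpha-\mathrm{proj}_\kappa(\alpha)$ for some $\alpha\in J^{\max_\kappa}$; then $x+\tau\in J^{\max_\kappa}$ and $\mathrm{proj}_\kappa(x+\tau)=x$ for every $x\in\mathrm{Ret}_\kappa(J)$. Writing $f=\sum_{\alpha\in J}c_\alpha\frac{w^\alpha}{\alpha!}$, the $\tau$-section retraction is $\mathrm{Ret}_\kappa^\tau(f)=\sum_{x\in\mathrm{Ret}_\kappa(J)}c_{x+\tau}\frac{w^x}{x!}$. *)

(* Defs.v *)
From mathcomp Require Import all_boot all_order all_algebra.
From mathcomp Require Import finmap mpoly polyrcf reals.

Set Implicit Arguments.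
Unset Strict Implicit.
Unset Printing Implicit Defensive.

Import Order.TTheory GRing.Theory Num.Theory.

Local Open Scope ring_scope.
Local Open Scope fset_scope.

Definition mnm_fact n (a : 'X_{1..n}) : nat := \prod_(i < n) (a i)`!.

(* The multinomial subtractions below are truncated, but never truncate:
   a j > b j >= 0 and b i > a i >= 0. *)
Definition M_convex n (r : nat) (J : {fset 'X_{1..n}}) : Prop :=
  [/\ J != fset0,
      forall a, a \in J -> mdeg a = r
    & forall a b, a \in J -> b \in J -> forall i, (a i < b i)%N ->
        exists j, [/\ (b j < a j)%N,
                      (a + U_(i) - U_(j))%MM \in J
                    & (b - U_(i) + U_(j))%MM \in J]].

Definition supp (R : realType) n (f : {mpoly R[n]}) : {fset 'X_{1..n}} :=
  [fset a in msupp f].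

(* Eigenvalues are counted with multiplicity, as roots of the characteristic
   polynomial. *)
Definition num_pos_eigenvalues (R : realType) n (A : 'M[R]_n) : nat :=
  (\sum_(x <- rootsR (char_poly A) | (0 < x)%R) mup x (char_poly A))%N.

Definition hessian (R : realType) n (p : {mpoly R[n]}) (v : 'I_n -> R)
    : 'M[R]_n :=
  \matrix_(i, j) (p^`M(i)^`M(j)).@[v].

(* The derivatives p^`M[b] below are quadratic forms, so their Hessians do not
   depend on the point v. *)
Definition lorentzian_of_degree (R : realType) n (r : nat) (f : {mpoly R[n]})
    : Prop :=
  [/\ f \is r.-homog,
      forall a, 0 <= f@_a
    & if (r < 2)%N then f <> 0
      else M_convex r (supp f) /\
           forall b : 'X_{1..n}, mdeg b = (r - 2)%N ->
             forall v, (num_pos_eigenvalues (hessian f^`M[b] v) <= 1)%N].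

Definition lorentzian (R : realType) n (f : {mpoly R[n]}) : Prop :=
  exists r, lorentzian_of_degree r f.

Definition proj n (k a : 'X_{1..n}) : 'X_{1..n} :=
  [multinom minn (a i) (k i) | i < n].

Definition coord_maximal n (S : {fset 'X_{1..n}}) (x : 'X_{1..n}) : bool :=
  (x \in S) && all (fun y => (x <= y)%MM ==> (y == x)) S.

Definition Jmax n (k : 'X_{1..n}) (J : {fset 'X_{1..n}}) : {fset 'X_{1..n}} :=
  [fset a in J | coord_maximal (proj k @` J) (proj k a)].

Definition Ret n (k : 'X_{1..n}) (J : {fset 'X_{1..n}}) : {fset 'X_{1..n}} :=
  proj k @` Jmax k J.

(* The truncated subtraction is exact here, as proj k a <= a. *)
Definition section_defining n (k : 'X_{1..n}) (J : {fset 'X_{1..n}})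
    (t : 'X_{1..n}) : Prop :=
  exists2 a, a \in Jmax k J & t = (a - proj k a)%MM.

(* The coefficient c_a of f in the basis of the w^a / a!. *)
Definition ncoef (R : realType) n (f : {mpoly R[n]}) (a : 'X_{1..n}) : R :=
  f@_a * (mnm_fact a)%:R.

Definition section_retraction (R : realType) n (k t : 'X_{1..n})
    (f : {mpoly R[n]}) : {mpoly R[n]} :=
  \sum_(x <- Ret k (supp f))
     (ncoef f (x + t)%MM / (mnm_fact x)%:R) *: 'X_[x].

(* Main.v *)
Require Import Defs.
From mathcomp Require Import all_boot all_order all_algebra.
From mathcomp Require Import zify finmap mpoly polyrcf complex reals.

(** Write g for the section retraction of f along t. In the normalized
    coefficients [ncoef] the derivative of f by t is a mere shift, and g keeps
    from the shifted polynomial the exponents x in [Ret k J]. When J is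
    M-convex these are exactly the x <= k with x + t in J ([Ret_sectionE]): the
    maximal elements of the projection of J all have the same degree
    ([mdeg_proj_max]), so an x <= k of the degree imposed by x + t in J is its
    own projection and is maximal. Thus g is the truncation to the box x <= k
    of the derivative of f by t, and both conditions on g become visible.

    The support of g is M-convex because an exchange step moves two points
    closer to each other and so never leaves a box ([M_convex_box]).

    For the Hessians, the (i, j) entry of the Hessian of the derivative by b is
    the normalized coefficient at b + e_i + e_j ([hessian_mderivmE]). Let A be
    the Hessian of the derivative of f by b + t. Truncation erases the rows and
    columns i with b + e_i outside the box, and beyond these only diagonal
    entries, those with b + e_i in the box but b + 2 e_i outside it. Erasing a
    nonnegative diagonal entry subtracts a positive semidefinite matrix, so g
    gets a principal submatrix of A minus a positive semidefinite matrix; by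
    the minimax principle it has no more positive eigenvalues than A
    ([num_pos_eigenvalues_restrict]).

    Here the minimax principle is used only in the form of a criterion: a real
    symmetric matrix has at most one positive eigenvalue iff its Hermitian form
    is nonpositive on the kernel of some linear functional
    ([one_pos_eigenvalueP]). Complex vectors are used so that the criterion
    follows from the unitary diagonalization of Hermitian matrices.

    If g has degree at most one, it only has to be nonzero, which holds because
    the point of J that defines the section survives in g. *)

Set Implicit Arguments.
Unset Strict Implicit.
Unset Printing Implicit Defensive.

Import Order.TTheory GRing.Theory Num.Theory.

Local Open Scope ring_scope.
Local Open Scope complex_scope.
Local Open Scope sesquilinear_scope.

(** * Real symmetric matrices with at most one positive eigenvalue *)

Definition hform (R : rcfType) n (A : 'M[R]_n) (u : 'rV[R[i]]_n) : R[i] :=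
  \sum_i \sum_j u 0 i * ((u 0 j)^*)%R * (A i j)%:C.

Lemma char_poly_conj (F : fieldType) n (P A : 'M[F]_n) : P \in unitmx ->
  char_poly (invmx P *m A *m P) = char_poly A.
Proof.
move=> Pu; rewrite /char_poly.
have -> : char_poly_mx (invmx P *m A *m P) =
    map_mx polyC (invmx P) *m char_poly_mx A *m map_mx polyC P.
  rewrite /char_poly_mx mulmxBr mulmxBl !map_mxM; congr (_ - _).
  rewrite mul_mx_scalar -scalemxAl -map_mxM mulVmx // map_mx1.
  by rewrite scalemx1.
rewrite !det_mulmx mulrC mulrA -det_mulmx -map_mxM mulmxV //.
by rewrite map_mx1 det1 mul1r.
Qed.

(** V comes from the unitary diagonalization of A, seen as a Hermitian matrix
    over [R[i]]; such a matrix has real eigenvalues. *)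
Lemma symmetric_spectrum (R : rcfType) n (A : 'M[R]_n) : A^T = A ->
  exists V : 'M[R[i]]_n, exists d : 'I_n -> R,
  [/\ V \in unitmx, char_poly A = \prod_i ('X - (d i)%:P)
    & forall u, hform A u = \sum_i (d i)%:C * `|(u *m V) 0 i| ^+ 2].
Proof.
move=> symA; pose AC := map_mx (real_complex R) A.
have hermAC : AC \is hermsymmx.
  apply: realsym_hermsym.
    apply/is_hermitianmxP; rewrite expr0 scale1r map_mx_id //.
    by rewrite /AC map_trmx symA.
  by apply/mxOverP => i j; rewrite mxE; apply/Creal_ImP; rewrite -complexIm.
have := hermitian_spectral_diag_real hermAC.
have := orthomx_spectralP (hermitian_normalmx hermAC).
have := spectral_unitarymx AC.
move: (spectralmx AC) (spectral_diag AC) => P sp uP eqA /mxOverP spR.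
pose d i := complex.Re (sp 0 i).
have spE : sp = \row_i (d i)%:C.
  apply/rowP => i; rewrite mxE /d.
  by apply/esym; rewrite RRe_real.
exists (P^t*), d; split.
- by rewrite unitarymx_unit // trmxC_unitary.
- apply: (map_poly_inj (real_complex R)).
  rewrite map_char_poly -/AC eqA char_poly_conj ?unitarymx_unit //.
  rewrite char_poly_trig ?diag_mx_is_trig //.
  rewrite rmorph_prod; apply: eq_bigr => i _.
  by rewrite spE !mxE eqxx mulr1n rmorphB /= map_polyX map_polyC.
- move=> u.
  have -> : hform A u = (u *m AC *m u^t*) 0 0.
    rewrite /hform exchange_big mxE; apply: eq_bigr => j _ /=.
    rewrite !mxE mulr_suml; apply: eq_bigr => i _.
    by rewrite !mxE mulrAC.
  rewrite eqA invmx_unitary // !mulmxA.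
  rewrite -mulmxA (_ : P *m u^t* = (u *m P^t*)^t*); last first.
    by rewrite trmx_mul map_mxM /= trmxCK.
  rewrite mul_mx_diag mxE; apply: eq_bigr => i _.
  by rewrite !mxE spE !mxE mulrAC mulrC normCK.
Qed.

Lemma num_pos_eigenvalues_split (R : realType) n (A : 'M[R]_n) (d : 'I_n -> R) :
  char_poly A = \prod_i ('X - (d i)%:P) ->
  num_pos_eigenvalues A = #|[pred i | 0 < d i]|.
Proof.
move=> eqA; rewrite /num_pos_eigenvalues eqA.
set p := \prod_i _.
have prod_neq0 (s : seq 'I_n) : \prod_(i <- s) ('X - (d i)%:P) != 0.
  by rewrite prodf_seq_neq0; apply/allP => i _ /=; rewrite polyXsubC_eq0.
have mup_prod x : mup x p = (\sum_i (d i == x))%N.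
  rewrite /p; elim: (index_enum _) => [|i s IHs].
    by rewrite !big_nil mupNroot // root1.
  rewrite !big_cons mupM ?polyXsubC_eq0 // IHs; congr (_ + _)%N.
  by rewrite -['X - _]expr1 mup_XsubCX; case: eqP.
rewrite (eq_bigr _ (fun x _ => mup_prod x)) exchange_big /= -sum1_card.
rewrite [RHS]big_mkcond /=; apply: eq_bigr => i _.
have root_di : d i \in rootsR p.
  rewrite -roots_on_rootsR ?prod_neq0 // in_itv /=.
  by rewrite /p (bigD1 i) //= rootM root_XsubC eqxx.
rewrite big_mkcond (bigD1_seq (d i)) ?uniq_roots //= eqxx big1 ?addn0.
  by rewrite inE.
by move=> x /negPf; rewrite eq_sym => ->; case: ifP.
Qed.

(** In eigencoordinates the form is a sum of d_i |y_i|^2. If at most one d_i is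
    positive, the functional y_i does the job. Conversely, two eigenvectors
    with positive eigenvalues span a plane on which the form is positive
    definite, and every linear functional vanishes somewhere on that plane. *)
Lemma one_pos_eigenvalueP (R : realType) n (A : 'M[R]_n) : A^T = A ->
  (num_pos_eigenvalues A <= 1)%N <->
  exists w : 'cV[R[i]]_n, forall u, u *m w = 0 -> hform A u <= 0.
Proof.
move=> /symmetric_spectrum[V [d [Vu charA formA]]].
rewrite (num_pos_eigenvalues_split charA); split=> [|[w wP]].
  rewrite leqNgt => d_le1.
  have [i0 di0|d_le0] := pickP [pred i | 0 < d i].
    exists (col i0 V) => u uw; rewrite formA; apply: sumr_le0 => i _.
    have [->|ne_i] := eqVneq i i0.
      have -> : (u *m V) 0 i0 = 0.
        have /matrixP/(_ 0 0) := uw; rewrite !mxE => uw0.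
        by rewrite -[RHS]uw0; apply: eq_bigr => k _; rewrite mxE.
      by rewrite normr0 expr0n mulr0.
    rewrite mulr_le0_ge0 ?exprn_ge0 // lecR leNgt; apply: contra d_le1 => di.
    by apply/card_gt1P; exists i, i0; rewrite !inE.
  exists 0 => u _; rewrite formA; apply: sumr_le0 => i _.
  by rewrite mulr_le0_ge0 ?exprn_ge0 // lecR leNgt; have /= -> := d_le0 i.
rewrite leqNgt; apply/card_gt1P => -[i [j [di dj ne_ij]]].
rewrite !inE in di dj.
pose x := invmx V *m w.
(* (a, b) is a nonzero solution of a x_i + b x_j = 0: e is a nonzero vector in
   the plane of the i-th and j-th eigenvectors that the functional w kills. *)
pose a := if x i 0 == 0 then 1 else x j 0.
pose b := if x i 0 == 0 then 0 else - x i 0.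
pose e : 'rV[R[i]]_n := a *: delta_mx 0 i + b *: delta_mx 0 j.
have ei : e 0 i = a by rewrite !mxE !eqxx (negPf ne_ij) mulr1 mulr0 addr0.
have ej : e 0 j = b.
  by rewrite !mxE !eqxx eq_sym (negPf ne_ij) mulr1 mulr0 add0r.
have ek k : k != i -> k != j -> e 0 k = 0.
  by move=> /negPf ki /negPf kj; rewrite !mxE ki kj !mulr0 addr0.
have ew : e *m invmx V *m w = 0.
  rewrite -mulmxA -/x mulmxDl -!scalemxAl -!rowE.
  apply/matrixP => k l; rewrite !ord1 /a /b.
  move: (x) => y; rewrite !mxE.
  by case: eqP => [->|_]; rewrite ?mulr0 ?mul0r ?addr0 // mulNr mulrC subrr.
have := wP _ ew; rewrite formA mulmxKV // => /le_gtF/negP; apply.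
rewrite (bigD1 i) //= (bigD1 j) 1?eq_sym //= big1 => [|k /andP[ki kj]].
  rewrite addr0 ei ej /a /b; case: (eqVneq (x i 0) 0) => [_|xi].
    by rewrite normr1 expr1n mulr1 normr0 expr0n mulr0 addr0 ltcR.
  rewrite ltr_wpDl //; first by rewrite mulr_ge0 ?exprn_ge0 // lecR ltW.
  by rewrite mulr_gt0 ?exprn_gt0 ?normr_gt0 ?oppr_eq0 // ltcR.
by rewrite ek // normr0 expr0n mulr0.
Qed.

(** B is the principal submatrix of A on S, padded with zeros, minus a
    nonnegative diagonal matrix. Hence the form of B at u is at most the form
    of A at the restriction of u to S, and a functional that works for A works
    for B once it is restricted to S. *)
Lemma num_pos_eigenvalues_restrict (R : realType) n (A B : 'M[R]_n)
    (S : pred 'I_n) :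
    A^T = A -> B^T = B ->
    (forall i j, i != j -> B i j = if S i && S j then A i j else 0) ->
    (forall i, B i i <= if S i then A i i else 0) ->
  (num_pos_eigenvalues A <= 1)%N -> (num_pos_eigenvalues B <= 1)%N.
Proof.
move=> symA symB offB diagB /(one_pos_eigenvalueP symA)[w wP].
apply/(one_pos_eigenvalueP symB).
exists (\col_i if S i then w i 0 else 0) => u uw.
pose v : 'rV[R[i]]_n := \row_i if S i then u 0 i else 0.
have /wP : v *m w = 0.
  rewrite -uw; apply/matrixP => k l; rewrite !ord1 !mxE.
  apply: eq_bigr => i _; rewrite !mxE.
  by case: ifP; rewrite ?mulr0 ?mul0r.
apply: le_trans; apply: ler_sum => i _; apply: ler_sum => j _.
rewrite !mxE; have [<-|ne_ij] := eqVneq i j; last first.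
  rewrite offB //; case: (S i); case: (S j);
  by rewrite /= ?conjC0 ?rmorph0 ?mulr0 ?mul0r ?lexx.
have {diagB} := diagB i; case: (S i) => leB.
  by rewrite -normCK; apply: ler_wpM2l; rewrite ?exprn_ge0 // lecR.
rewrite mul0r mul0r -normCK.
by apply: mulr_ge0_le0; rewrite ?exprn_ge0 // lecR.
Qed.

(** * Projections and sections of M-convex sets *)

Lemma leq_mdeg n (x y : 'X_{1..n}) : (x <= y)%MM -> (mdeg x <= mdeg y)%N.
Proof. by move=> /mnm_lepP le_xy; rewrite !mdegE leq_sum. Qed.

Lemma mnm_le_mdeg_eq n (x y : 'X_{1..n}) :
  (x <= y)%MM -> (mdeg y <= mdeg x)%N -> x = y.
Proof.
move=> le_xy; rewrite -{1}(submK le_xy) mdegD -[leqRHS]add0n leq_add2r leqn0.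
by rewrite mdeg_eq0 => /eqP yx; rewrite -(submK le_xy) yx add0m.
Qed.

Lemma coord_maximal_eq n (S : {fset 'X_{1..n}}) x y :
  coord_maximal S x -> y \in S -> (x <= y)%MM -> y = x.
Proof. by case/andP => _ /allP maxx /maxx/implyP h /h/eqP. Qed.

(** A coordinatewise maximal element of the projection has maximal degree.
    Otherwise take b with a projection of larger degree, as close to a as
    possible, and exchange at an i where the projection of b is larger. If the
    coordinate j that a gives up exceeds k j, its loss is invisible to the
    projection of a, which would grow at i: this contradicts maximality. If
    not, the projection of b gains at j, so its degree does not drop while b
    comes closer to a. *)
Lemma mdeg_proj_max n r (k : 'X_{1..n}) (J : {fset 'X_{1..n}}) a b :
    M_convex r J -> a \in J -> coord_maximal (proj k @` J)%fset (proj k a) ->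
  b \in J -> (mdeg (proj k b) <= mdeg (proj k a))%N.
Proof.
case=> _ _ exchange aJ max_a.
have [m] := ubnP (\sum_l (b l - a l))%N; elim: m b => // m IHm b lt_m bJ.
rewrite leqNgt; apply/negP => lt_deg.
have [i lt_i] : exists i, (proj k a i < proj k b i)%N.
  apply/existsP; apply: contraLR lt_deg; rewrite negb_exists => /forallP le_ba.
  by rewrite -leqNgt leq_mdeg //; apply/mnm_lepP => i; rewrite leqNgt.
have [ak ab] : (a i < k i)%N /\ (a i < b i)%N.
  by move: lt_i; rewrite !mnmE; lia.
have [j [ba aJ' bJ']] := exchange _ _ aJ bJ i ab.
have ne_ij : i != j by apply: contraTneq ba => <-; rewrite -leqNgt ltnW.
have le_ajk : (a j <= k j)%N.
  rewrite leqNgt; apply/negP => lt_kja.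
  have := coord_maximal_eq max_a (in_imfset _ (proj k) aJ').
  have -> : proj k (a + U_(i) - U_(j)) = (proj k a + U_(i))%MM.
    apply/mnmP => l; rewrite !mnmE.
    have [<-|ne_il] := eqVneq i l; first by rewrite eq_sym (negPf ne_ij); lia.
    by have [<-|ne_jl] := eqVneq j l; lia.
  rewrite lem_addr // => /(_ isT) /(congr1 mdeg)/eqP.
  by rewrite mdegD mdeg1; lia.
have /IHm := bJ'; apply/implyP; rewrite negb_imply; apply/andP; split.
  rewrite ltnS in lt_m; apply: leq_trans lt_m.
  rewrite (bigD1 i) //= [leqRHS](bigD1 i) //= -addSn leq_add //.
    by rewrite !mnmE eqxx eq_sym (negPf ne_ij); lia.
  apply: leq_sum => l ne_li; rewrite !mnmE eq_sym (negPf ne_li).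
  by have [<-|ne_jl] := eqVneq j l; lia.
rewrite -ltnNge (leq_trans lt_deg) //.
(* Moving U_(i) and U_(j) to the other sides keeps subtraction, and hence
   truncation, out of the degree count. *)
have : (proj k b + U_(j) <= proj k (b - U_(i) + U_(j)) + U_(i))%MM.
  apply/mnm_lepP => l; rewrite !mnmE.
  have [<-|ne_il] := eqVneq i l; first by rewrite eq_sym (negPf ne_ij); lia.
  by have [<-|ne_jl] := eqVneq j l; lia.
by move/leq_mdeg; rewrite !mdegD !mdeg1; lia.
Qed.

(** The retraction can be read off from the shifted support alone, with no
    reference to maximality: all points of J have degree r, so x + t in J
    forces x to have the largest degree among the projections. *)
Lemma Ret_sectionE n r (k t : 'X_{1..n}) (J : {fset 'X_{1..n}}) x :
    M_convex r J -> section_defining k J t -> (x + t)%MM \in J ->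
  (x \in Ret k J) = (x <= k)%MM.
Proof.
move=> convJ [a aJmax tE] xtJ.
have /andP[aJ max_a] : (a \in J) && coord_maximal (proj k @` J)%fset (proj k a).
  by move: aJmax; rewrite !inE.
apply/imfsetP/mnm_lepP => [[b _ ->] i|le_xk]; first by rewrite mnmE geq_minr.
have le_pa : (proj k a <= a)%MM by apply/mnm_lepP => i; rewrite mnmE geq_minl.
have deg_x : mdeg x = mdeg (proj k a).
  have [_ degJ _] := convJ.
  apply/eqP; rewrite -(eqn_add2r (mdeg t)) -!mdegD degJ // tE.
  by rewrite addmC submK // degJ.
have xE : x = proj k (x + t).
  apply: mnm_le_mdeg_eq; last by rewrite deg_x (mdeg_proj_max convJ).
  by apply/mnm_lepP => i; rewrite !mnmE leq_min leq_addr le_xk.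
exists (x + t)%MM => //; rewrite !inE xtJ -xE /=.
apply/andP; split; first by apply/imfsetP; exists (x + t)%MM.
apply/allP => _ /imfsetP[b bJ ->]; apply/implyP => le_xb.
rewrite eq_sym; apply/eqP; apply: mnm_le_mdeg_eq => //.
by rewrite deg_x (mdeg_proj_max convJ).
Qed.

(** A coordinate that grows in an exchange stays below the same coordinate of
    the other point, hence below the bound k. *)
Lemma M_convex_box n r (J : {fset 'X_{1..n}}) (K : {fset 'X_{1..n}})
    (k t : 'X_{1..n}) :
    M_convex r J -> K != fset0 ->
    (forall x, (x \in K) = (x <= k)%MM && ((x + t)%MM \in J)) ->
  M_convex (r - mdeg t) K.
Proof.
move=> [_ degJ exchange] K0 KE; split=> [//|x|x y].
  by rewrite KE => /andP[_ /degJ <-]; rewrite mdegD addnK.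
rewrite !KE => /andP[/mnm_lepP xk xJ] /andP[/mnm_lepP yk yJ] i lt_i.
have [|j [lt_j xJ' yJ']] := exchange _ _ xJ yJ i;
  first by rewrite !mnmE ltn_add2r.
exists j; move: lt_j; rewrite !mnmE ltn_add2r => lt_j.
have ne_ij : i != j by apply: contraTneq lt_j => <-; rewrite -leqNgt ltnW.
split=> //; rewrite KE; apply/andP; split.
- apply/mnm_lepP => l; rewrite !mnmE; have := xk l; have := yk l.
  by have [<-|ne_il] := eqVneq i l; lia.
- suff <- : (x + t + U_(i) - U_(j))%MM = (x + U_(i) - U_(j) + t)%MM by [].
  by apply/mnmP => l; rewrite !mnmE; have [<-|ne_jl] := eqVneq j l; lia.
- apply/mnm_lepP => l; rewrite !mnmE; have := xk l; have := yk l.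
  by have [<-|ne_jl] := eqVneq j l; lia.
- suff <- : (y + t - U_(i) + U_(j))%MM = (y - U_(i) + U_(j) + t)%MM by [].
  by apply/mnmP => l; rewrite !mnmE; have [<-|ne_il] := eqVneq i l; lia.
Qed.

(** * Normalized coefficients and the section retraction *)

Lemma mnm_fact_gt0 n (a : 'X_{1..n}) : (0 < mnm_fact a)%N.
Proof. by rewrite prodn_gt0 // => i; rewrite fact_gt0. Qed.

Lemma ncoef_eq0 (R : realType) n (f : {mpoly R[n]}) a :
  (ncoef f a == 0) = (a \notin supp f).
Proof.
rewrite /supp !inE /= -mcoeff_eq0 mulf_eq0 pnatr_eq0.
by rewrite -[mnm_fact a == _]negbK -lt0n mnm_fact_gt0 orbF.
Qed.

(** Differentiating r times a form of degree r leaves a constant, which is the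
    normalized coefficient at the multi-exponent of the derivative. *)
Lemma hessian_mderivmE (R : realType) n r (f : {mpoly R[n]}) b v i j :
    f \is r.-homog -> (mdeg b + 2)%N = r ->
  hessian f^`M[b] v i j = ncoef f (b + U_(i) + U_(j))%MM.
Proof.
move=> homf degb; rewrite mxE -!mderivmU1m -!mderivmDm addmA.
set c := (b + U_(i) + U_(j))%MM.
have degc : mdeg c = r by rewrite !mdegD !mdeg1 -degb -addnA.
suff -> : f^`M[c] = (ncoef f c)%:MP by rewrite mevalC.
apply/mpolyP => m; rewrite mcoeff_mderivm mcoeffC.
have [->|m0] := eqVneq m 0%MM.
  rewrite addm0 mulr1 /ncoef mulr_natr; congr (_ *+ _).
  by apply: eq_bigr => l _; rewrite ffactnn.
rewrite mulr0 (dhomog_nemf_coeff homf) ?mul0rn //=.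
by rewrite mdegD degc -[X in _ != X]addn0 eqn_add2l mdeg_eq0.
Qed.

Lemma mcoeff_section_retraction (R : realType) n (k t : 'X_{1..n})
    (f : {mpoly R[n]}) x :
  (section_retraction k t f)@_x =
    if x \in Ret k (supp f) then ncoef f (x + t)%MM / (mnm_fact x)%:R else 0.
Proof.
rewrite /section_retraction raddf_sum /=; case: ifP => xRet.
  rewrite (bigD1_seq x) ?fset_uniq //= mcoeffZ mcoeffX eqxx mulr1.
  rewrite big1 ?addr0 // => y ne_yx.
  by rewrite mcoeffZ mcoeffX (negPf ne_yx) mulr0.
rewrite big_seq big1 // => y yRet; rewrite mcoeffZ mcoeffX.
by case: eqP yRet => [->|_]; rewrite ?xRet ?mulr0.
Qed.

Lemma ncoef_section_retraction (R : realType) n (k t : 'X_{1..n})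
    (f : {mpoly R[n]}) x :
  ncoef (section_retraction k t f) x =
    if x \in Ret k (supp f) then ncoef f (x + t)%MM else 0.
Proof.
rewrite {1}/ncoef mcoeff_section_retraction.
case: ifP => _; rewrite ?mul0r // divfK // pnatr_eq0 -lt0n.
exact: mnm_fact_gt0.
Qed.

Lemma supp_section_retraction (R : realType) n (k t : 'X_{1..n})
    (f : {mpoly R[n]}) x :
  (x \in supp (section_retraction k t f)) =
    (x \in Ret k (supp f)) && ((x + t)%MM \in supp f).
Proof.
rewrite -[LHS]negbK -ncoef_eq0 ncoef_section_retraction.
by case: ifP; rewrite ?eqxx // ncoef_eq0 negbK.
Qed.

Theorem corollary6p3 (R : realType) (n r : nat) (f : {mpoly R[n]})
    (J : {fset 'X_{1..n}}) (kappa tau : 'X_{1..n})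
    (hf : lorentzian_of_degree r f) (hJ : supp f = J)
    (htau : section_defining kappa J tau) :
  lorentzian (section_retraction kappa tau f).
Proof.
set g := section_retraction kappa tau f.
have [homf f_ge0 lorf] := hf.
have homg : g \is (r - mdeg tau).-homog.
  apply/dhomogP => x xg; have : x \in supp g by rewrite !inE.
  rewrite supp_section_retraction => /andP[_]; rewrite !inE => xtf.
  by rewrite -(dhomogP _ _ _ homf _ xtf) /= mdegD addnK.
have ncoef_ge0 a : 0 <= ncoef f a by rewrite mulr_ge0.
have g_ge0 a : 0 <= g@_a.
  by rewrite mcoeff_section_retraction; case: ifP => // _; rewrite divr_ge0.
have [a aJmax tauE] := htau.
have aJ : a \in J by move: aJmax; rewrite !inE => /andP[].
have pa_g : proj kappa a \in supp g.
  rewrite supp_section_retraction hJ in_imfset //= tauE addmC submK //.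
  by apply/mnm_lepP => i; rewrite mnmE geq_minl.
exists (r - mdeg tau)%N; split=> //; case: ifP => [_|/negbT].
  by move=> g0; move: pa_g; rewrite g0 !inE msupp0.
rewrite -leqNgt => deg_ge2.
have r_ge2 : (r < 2)%N = false by lia.
move: lorf; rewrite r_ge2 hJ => -[convJ hessf].
have RetE x : (x + tau)%MM \in J -> (x \in Ret kappa J) = (x <= kappa)%MM.
  exact: Ret_sectionE convJ htau.
split.
  apply: (M_convex_box convJ); first by apply/fset0Pn; exists (proj kappa a).
  move=> x; rewrite supp_section_retraction hJ andbC [RHS]andbC.
  by case: (boolP (_ \in J)) => // /RetE ->.
move=> b degb v.
have degb2 : (mdeg b + 2)%N = (r - mdeg tau)%N by lia.
have degbt : (mdeg (b + tau) + 2)%N = r by rewrite mdegD; lia.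
pose A := hessian f^`M[b + tau] v.
have AE i j : A i j = ncoef f (b + U_(i) + U_(j) + tau)%MM.
  rewrite /A (hessian_mderivmE _ _ _ homf) //; congr (ncoef f _).
  by apply/mnmP => l; rewrite !mnmE; lia.
have BE i j : hessian g^`M[b] v i j =
    if (b + U_(i) + U_(j) <= kappa)%MM then A i j else 0.
  rewrite (hessian_mderivmE _ _ _ homg) // ncoef_section_retraction AE hJ.
  set x := (b + U_(i) + U_(j))%MM.
  have [/RetE -> //|xJ] := boolP ((x + tau)%MM \in J).
  have -> : ncoef f (x + tau) = 0 by apply/eqP; rewrite ncoef_eq0 hJ.
  by rewrite !if_same.
have symh (p : {mpoly R[n]}) : (hessian p v)^T = hessian p v.
  by apply/matrixP => i j; rewrite !mxE mderiv_comm.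
(* Off the diagonal, b + U_(i) + U_(j) is in the box as soon as b + U_(i) and
   b + U_(j) are; on the diagonal this can fail, and there A is nonnegative. *)
pose S i := (b + U_(i) <= kappa)%MM.
apply: (@num_pos_eigenvalues_restrict _ _ A _ S); rewrite /A ?symh //.
- move=> i j ne_ij; rewrite -/A BE; congr (if _ then _ else _).
  apply/mnm_lepP/andP => [le_k|[/mnm_lepP le_i /mnm_lepP le_j] l].
    by split; apply/mnm_lepP => l; have := le_k l; rewrite !mnmE; lia.
  have := le_i l; have := le_j l; rewrite !mnmE.
  by have [<-|_] := eqVneq i l; rewrite ?[j == i]eq_sym ?(negPf ne_ij); lia.
- move=> i; rewrite -/A BE; case: ifP => [le_k|_].
    suff -> : S i by [].
    by apply: lepm_trans le_k; rewrite lem_addr.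
  by case: ifP => // _; rewrite AE.
- by apply: hessf; lia.
Qed.
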